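(* Let $\mathcal{D}$ and $\mathcal{F}$ be a diffeology and a Sikorski structure on a set $X$. Denote by $\tau_{\mathcal{D}}$ the D-topology on $X$ induced by $\mathcal{D}$ and by $\tau_{\mathcal{F}}$ the initial topology on $X$ induced by $\mathcal{F}$. For a subset $V\subseteq X$, let $\mathcal{D}_V$ and $\mathcal{F}_V$ be the subset diffeology and the subspace Sikorski structure on $V$. (1) Suppose that for every point in $X$ there is a $\tau_{\mathcal{D}}$-open neighbourhood $V$ such that $(\mathcal{D}_V,V,\mathcal{F}_V)$ is a compatible triple. Then $(\mathcal{D},X,\mathcal{F})$ is a compatible triple. In particular, the topology $\tau_{\mathcal{D}}$ contains the topology $\tau_{\mathcal{F}}$. (2) Suppose that the topology $\tau_{\mathcal{D}}$ contains the topology $\tau_{\mathcal{F}}$ and that for every point in $X$ there is a $\tau_{\mathcal{F}}$-open neighbourhood $V$ such that $(\mathcal{D}_V,V,\mathcal{F}_V)$ is a reflexive triple. Then $(\mathcal{D},X,\mathcal{F})$ is a reflexive triple.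
   Context: ''Smooth'' means $C^\infty$. A cartesian space is $\mathbb{R}^d$ for some $d\in\mathbb{N}$, with its standard smooth structure. Sikorski structures. A Sikorski structure on a set $X$ is a non-empty collection $\mathcal{F}_X$ of real-valued functions on $X$ such that, with $X$ equipped with the initial topology (the weakest topology making all functions in $\mathcal{F}_X$ continuous): (S1) if $f_1,\ldots,f_n\in\mathcal{F}_X$ and $g\in C^\infty(\mathbb{R}^n)$, then $g\circ(f_1,\ldots,f_n)\in\mathcal{F}_X$; (S2) given $f\colon X\to\mathbb{R}$, if for each point of $X$ there exist a neighbourhood $V$ and $g\in\mathcal{F}_X$ with $g|_V=f|_V$, then $f\in\mathcal{F}_X$. A map between Sikorski spaces $(X,\mathcal{F}_X)\to(Y,\mathcal{F}_Y)$ is Sikorski smooth if its composition with every function in $\mathcal{F}_Y$ is in $\mathcal{F}_X$. A manifold (in particular an open subset of a cartesian space) carries the Sikorski structure of all $C^\infty$ real-valued functions. For a subset $V$ of a Sikorski space $(X,\mathcal{F}_X)$, the subspace Sikorski structure is the set of functions $f\colon V\to\mathbb{R}$ such that each point of $V$ has a neighbourhood $W$ in $X$ and a function $g\in\mathcal{F}_X$ with $g|_{V\cap W}=f|_{V\cap W}$. Diffeologies. A diffeology on a set $X$ is a collection $\mathcal{D}_X$ of maps (plots) from open subsets of cartesian spaces to $X$ such that: (D1) constant maps are plots; (D2) precompositions of plots with $C^\infty$ maps between open subsets of cartesian spaces are plots; (D3) $p\colon U\to X$ is a plot if each point of $U$ has a neighbourhood $V$ with $p|_V$ a plot. A map between diffeological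 spaces is diffeologically smooth if its precomposition with every plot of the source is a plot of the target; a manifold carries the diffeology of all $C^\infty$ maps from open subsets of cartesian spaces. For a subset $V$ of a diffeological space $(X,\mathcal{D}_X)$, the subset diffeology is the set of maps $p\colon U\to V$ from open subsets $U$ of cartesian spaces whose composition with the inclusion $V\to X$ is in $\mathcal{D}_X$. The D-topology on a diffeological space is the strongest topology for which all plots are continuous. For a Sikorski structure $\mathcal{F}_X$, $\Pi\mathcal{F}_X$ denotes the diffeology of all Sikorski smooth maps from open subsets of cartesian spaces to $X$. For a diffeology $\mathcal{D}_X$, $\Phi\mathcal{D}_X$ denotes the Sikorski structure of all diffeologically smooth real-valued functions on $X$. A triple $(\mathcal{D}_X,X,\mathcal{F}_X)$ is compatible if $f\circ p$ is smooth for all $p\in\mathcal{D}_X$ and $f\in\mathcal{F}_X$; it is reflexive if $\Phi\mathcal{D}_X=\mathcal{F}_X$ and $\Pi\mathcal{F}_X=\mathcal{D}_X$. *)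

(* Defs.v *)
From HB Require Import structures.
From mathcomp Require Import all_boot all_order all_algebra.
From mathcomp Require Import all_classical all_reals all_analysis.

Set Implicit Arguments.
Unset Strict Implicit.
Unset Printing Implicit Defensive.

Import Order.TTheory GRing.Theory Num.Theory.
Import numFieldNormedType.Exports.
Local Open Scope classical_set_scope.
Local Open Scope ring_scope.

(* A set coerces to its subtype, so a function defined on the subset V only
   is a function V -> Y; [set_val] is the inclusion of V.                      *)

Section topologies.
Context {X : Type}.

(* [set0] is the union of the empty family. *)
Definition is_topology (tau : set (set X)) : Prop :=
  [/\ tau setT,
      forall A B, tau A -> tau B -> tau (A `&` B) &
      forall G, G `<=` tau -> tau (\bigcup_(A in G) A)].

Definition neighbourhood (tau : set (set X)) (x : X) (V : set X) : Prop :=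
  exists O, [/\ tau O, O x & O `<=` V].

End topologies.

Section smooth_functions.
Context {R : realType}.

(* Derivatives of [g] up to order k at the points of an open set U depend only
   on the values of [g] on U.                                                  *)
Fixpoint C_on (k d : nat) (U : set 'rV[R]_d) (g : 'rV[R]_d -> R) : Prop :=
  (forall x, U x -> {for x, continuous g}) /\
  if k is k'.+1 then
    forall i : 'I_d,
      (forall x, U x -> derivable g x (delta_mx 0 i)) /\
      C_on k' U (fun x => 'D_(delta_mx 0 i) g x)
  else True.

Definition Coo_on (d : nat) (U : set 'rV[R]_d) (g : 'rV[R]_d -> R) : Prop :=
  forall k, C_on k U g.

(* Only meant for U open. The extension [g] is arbitrary outside U. *)
Definition smooth (d : nat) (U : set 'rV[R]_d) (f : U -> R) : Prop :=
  exists2 g : 'rV[R]_d -> R, (forall u : U, g (set_val u) = f u) & Coo_on U g.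

Definition smooth_map (d e : nat) (W : set 'rV[R]_d) (U : set 'rV[R]_e)
    (h : W -> U) : Prop :=
  forall j : 'I_e, smooth (fun w : W => set_val (h w) 0 j).

End smooth_functions.

Section sikorski.
Context {R : realType}.

(* The weakest topology making the functions of F continuous. *)
Definition initial_top (X : Type) (F : set (X -> R)) : set (set X) :=
  \bigcap_(tau in [set tau | is_topology tau /\
      forall f, F f -> forall O : set R, open O -> tau (f @^-1` O)]) tau.

Definition sikorski_structure (X : Type) (F : set (X -> R)) : Prop :=
  [/\ F !=set0,
      forall (n : nat) (f : 'I_n -> X -> R) (g : 'rV[R]_n -> R),
        (forall i, F (f i)) -> Coo_on setT g ->
        F (fun x => g (\row_i f i x)) &
      forall f : X -> R,
        (forall x, exists2 V, neighbourhood (initial_top F) x V &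
           exists2 g, F g & {in V, g =1 f}) ->
        F f].

Definition sikorski_smooth (X Y : Type) (FX : set (X -> R)) (FY : set (Y -> R))
    (phi : X -> Y) : Prop :=
  forall f, FY f -> FX (f \o phi).

Definition open_sikorski (d : nat) (U : set 'rV[R]_d) : set (U -> R) :=
  [set f | smooth f].

Definition subspace_sikorski (X : Type) (F : set (X -> R)) (V : set X) :
    set (V -> R) :=
  [set f | forall x : V,
     exists2 W, neighbourhood (initial_top F) (set_val x) W &
     exists2 g, F g & forall v : V, W (set_val v) -> g (set_val v) = f v].

End sikorski.
Arguments open_sikorski {R d} U.
Arguments subspace_sikorski {R X} F V.

(* A map to X from an open subset of a cartesian space. *)
Record parametrization (R : realType) (X : Type) := Parametrization {
  pdim : nat;
  pdom : set 'rV[R]_pdim;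
  pdom_open : open pdom;
  pmap :> pdom -> X }.
Arguments pdim {R X} p.
Arguments pdom {R X} p.
Arguments pdom_open {R X} p.
Arguments pmap {R X} p.
Arguments Parametrization {R X pdim pdom}.

Section diffeology.
Context {R : realType}.

Definition param_comp (X Y : Type) (phi : X -> Y) (p : parametrization R X) :
    parametrization R Y :=
  Parametrization (pdom_open p) (phi \o p).

Definition diffeology (X : Type) (D : set (parametrization R X)) : Prop :=
  [/\ forall (d : nat) (U : set 'rV[R]_d) (oU : open U) (x : X),
        D (Parametrization oU (fun=> x)),
      forall p, D p ->
        forall (d : nat) (W : set 'rV[R]_d) (oW : open W) (h : W -> pdom p),
        smooth_map h -> D (Parametrization oW (p \o h)) &
      forall p : parametrization R X,
        (forall u : pdom p,
           exists (V : set 'rV[R]_(pdim p)) (oV : open V) (VU : V `<=` pdom p),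
             V (set_val u) /\ D (Parametrization oV (p \o subfun VU))) ->
        D p].

Definition diff_smooth (X Y : Type) (DX : set (parametrization R X))
    (DY : set (parametrization R Y)) (phi : X -> Y) : Prop :=
  forall p, DX p -> DY (param_comp phi p).

Definition real_diffeology : set (parametrization R R) :=
  [set p | smooth (pmap p)].

Definition subset_diffeology (X : Type) (D : set (parametrization R X))
    (V : set X) : set (parametrization R V) :=
  [set p | D (param_comp set_val p)].

Definition plots_continuous (X : Type) (D : set (parametrization R X))
    (tau : set (set X)) : Prop :=
  forall p, D p -> forall A, tau A -> open (pmap p @^-1` A).

(* The strongest topology for which the plots are continuous: the union of all
   topologies with that property, itself such a topology (see [D_topP]).       *)
Definition D_top (X : Type) (D : set (parametrization R X)) : set (set X) :=
  \bigcup_(tau in [set tau | is_topology tau /\ plots_continuous D tau]) tau.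

End diffeology.
Arguments subset_diffeology {R X} D V.

Section triples.
Context {R : realType} {X : Type}.
Implicit Types (D : set (parametrization R X)) (F : set (X -> R)).

Definition Pi F : set (parametrization R X) :=
  [set p | sikorski_smooth (open_sikorski (pdom p)) F p].

Definition Phi D : set (X -> R) := [set f | diff_smooth D real_diffeology f].

Definition compatible D F : Prop :=
  forall p f, D p -> F f -> smooth (f \o p).

Definition reflexive_triple D F : Prop := Phi D = F /\ Pi F = D.

End triples.

Section extremal_topologies.
Context {R : realType} {X : Type}.

Lemma initial_topP (F : set (X -> R)) :
  is_topology (initial_top F) /\
  forall f, F f -> forall O : set R, open O -> initial_top F (f @^-1` O).
Proof.
split; last by move=> f Ff O oO tau [_]; exact.
split.
- by move=> tau [[]].
- by move=> A B tA tB tau ttau; have [[_ tI _] _] := ttau; apply: tI;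
    [exact: tA|exact: tB].
- move=> G sG tau ttau; have [[_ _ tU] _] := ttau.
  by apply: tU => A /sG; exact.
Qed.

Let open_preimages (D : set (parametrization R X)) : set (set X) :=
  [set A | forall p, D p -> open (pmap p @^-1` A)].

Let open_preimages_topology D : is_topology (open_preimages D).
Proof.
split.
- by move=> p Dp; rewrite preimage_setT; exact: openT.
- by move=> B C hB hC p Dp; rewrite preimage_setI; apply: openI; auto.
- move=> G sG p Dp; rewrite preimage_bigcup.
  by apply: bigcup_open => B /sG; exact.
Qed.

Lemma D_topE (D : set (parametrization R X)) :
  D_top D = [set A | forall p, D p -> open (pmap p @^-1` A)].
Proof.
apply/seteqP; split=> [A [tau [_ ct] tA] p Dp|A hA]; first exact: ct tA.
exists (open_preimages D) => //; split; first exact: open_preimages_topology.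
by move=> p Dp B; exact.
Qed.

Lemma D_topP (D : set (parametrization R X)) :
  is_topology (D_top D) /\ plots_continuous D (D_top D).
Proof.
rewrite D_topE; split; first exact: open_preimages_topology.
by move=> p Dp A; exact.
Qed.

End extremal_topologies.

(* Main.v *)
Require Import Defs.
From mathcomp Require Import all_boot all_order all_algebra.
From mathcomp Require Import all_classical all_reals all_analysis.

Import numFieldNormedType.Exports.
Local Open Scope classical_set_scope.

(** Every clause of the proposition is a statement about plots and functions
    near a point, so the proof consists in restricting to a small set, using
    the hypothesis there, and gluing.

    The analytic input is that smoothness of a function on an open set of a
    cartesian space is local ([smooth_local]): values, limits and directional
    derivatives at a point only depend on the germ of the function
    ([C_on_germ]).  Restrictions of plots are plots because inclusions of open
    sets are smooth maps ([smooth_map_subfun]).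

    For the first part, let [p] be a plot and [f] an element of [F].  Near a point [u] of its domain, [p] takes its values in a D-open set [V] on
    which the triple is compatible, so [f \o p] is smooth near [u].  The
    inclusion of topologies holds for every compatible triple: smooth functions
    are continuous, so a plot pulls the subbasic open sets [f @^-1` O], hence
    all open sets of the initial topology, back to open sets.

    For the second part, a reflexive triple is compatible, and the inclusion of
    topologies makes the given neighbourhoods D-open, so the first part yields
    [D `<=` Pi F] and [F `<=` Phi D].  Conversely, a function in [Phi D] restricts to a function
    in [Phi D_V = F_V], hence coincides near each point with an element of
    [F], so it lies in [F] ([Phi_sub_local]).  A map in [Pi F] is continuous for
    the initial topology, so it restricts near each point to a map in
    [Pi F_V = D_V]; being locally a plot, it is a plot ([Pi_sub_local]). *)

(** * Locality of smoothness on open sets of cartesian spaces *)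

Section local_smoothness.
Local Open Scope ring_scope.
Context {R : realType}.

(** At each order, continuity and directional derivatives at a point only
    involve the values near it.  As [h] may vary with the point, this also
    serves for shrinking [U] and for changing [g] outside [U]. *)
Lemma C_on_germ {k d : nat} {U : set 'rV[R]_d} {g : 'rV[R]_d -> R} :
  (forall x, U x -> exists V h,
    [/\ open V, V x, forall y, V y -> h y = g y & C_on k V h]) ->
  C_on k U g.
Proof.
have near_eq (V : set 'rV[R]_d) (h g' : 'rV[R]_d -> R) x :
    open V -> V x -> (forall y, V y -> h y = g' y) ->
    \forall y \near x, h y = g' y.
  by move=> oV Vx hg'; exact: filterS (open_nbhs_nbhs (conj oV Vx)).
have continuous_germ (V : set 'rV[R]_d) (h g' : 'rV[R]_d -> R) x :
    open V -> V x -> (forall y, V y -> h y = g' y) ->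
    {for x, continuous h} -> {for x, continuous g'}.
  move=> oV Vx hg'; rewrite /prop_for /continuous_at (hg' _ Vx).
  exact: cvg_trans (near_eq_cvg (near_eq _ _ _ _ oV Vx hg')).
elim: k U g => [|k IHk] U g loc; split => //;
  try by move=> x /loc [V [h [oV Vx hg [hc _]]]];
    exact: continuous_germ oV Vx hg (hc x Vx).
move=> i; split=> [x /loc [V [h [oV Vx hg [_ /(_ i) [dh _]]]]]|].
  exact: near_eq_derivable (near_eq _ _ _ _ oV Vx hg) (dh x Vx).
apply: IHk => x /loc [V [h [oV Vx hg [_ /(_ i) [_ Ch]]]]].
exists V, (fun y => 'D_(delta_mx 0 i) h y); split => // y Vy.
exact: near_eq_derive (near_eq _ _ _ _ oV Vy hg).
Qed.

(** The local extensions [h] of the restrictions of [f] need not agree outside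
    [U], hence the global extension of [f] by zero, which has the germ of the
    local extension at each point of [U] because [W] is open. *)
Lemma smooth_local {d : nat} {U : set 'rV[R]_d} {f : U -> R} :
  (forall u : U, exists (W : set 'rV[R]_d) (WU : W `<=` U),
    [/\ open W, W (set_val u) & smooth (f \o subfun WU)]) ->
  smooth f.
Proof.
have valLE (u : U) : valL_ 0 f (set_val u) = f u.
  by have /(congr1 (fun h : U -> R => h u)) := @valLK _ _ 0 U f.
move=> loc; exists (valL_ 0 f) => // k.
apply: C_on_germ => x Ux.
have [W [WU [oW Wx [h hf Ch]]]] := loc (SigSub (mem_set Ux)).
exists W, h; split => // y Wy; rewrite (hf (SigSub (mem_set Wy))).
exact/esym/(valLE (subfun WU (SigSub (mem_set Wy)))).
Qed.

Lemma smooth_subfun {d : nat} {W U : set 'rV[R]_d} (WU : W `<=` U) {f : U -> R} :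
  open U -> smooth f -> smooth (f \o subfun WU).
Proof.
move=> oU [g gf Cg]; exists g => [w|k]; first exact: (gf (subfun WU w)).
by apply: C_on_germ => x /WU Ux; exists U, g.
Qed.

Lemma C_on_cst (k d : nat) (U : set 'rV[R]_d) (c : R) : C_on k U (cst c).
Proof.
elim: k c => [|k IHk] c; split => //; try by move=> x _; exact: cst_continuous.
move=> i; split=> [x _|]; first exact: derivable_cst.
by rewrite (_ : (fun x => _) = cst 0) //; apply/funext => x; exact: derive_cst.
Qed.

(** The derivatives of a linear form are constant. *)
Lemma Coo_on_linear (d : nat) (U : set 'rV[R]_d) (f : {linear 'rV[R]_d -> R}) :
  continuous f -> Coo_on U f.
Proof.
move=> fc [|k]; split => //; try by move=> x _; exact: fc.
move=> i; split=> [x _|].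
  exact/diff_derivable/linear_differentiable.
rewrite (_ : (fun x => _) = cst (f (delta_mx 0 i))); first exact: C_on_cst.
apply/funext => x; rewrite deriveE ?diff_lin//.
exact: linear_differentiable.
Qed.

Lemma smooth_map_subfun {d : nat} {W U : set 'rV[R]_d} (WU : W `<=` U) :
  smooth_map (subfun WU).
Proof.
move=> j; have @f : {linear 'rV[R]_d -> R}.
  by exists (fun x : 'rV[R]_d => x 0 j); do 2![eexists]; do ?[constructor];
     rewrite ?mxE// => ? *; rewrite ?mxE//; move=> ?; rewrite !mxE.
exists f => //; apply: Coo_on_linear; exact: coord_continuous.
Qed.

Lemma open_subtypeP {d : nat} {U : set 'rV[R]_d} {A : set U} : open U ->
  open A <-> exists W, [/\ open W, W `<=` U & forall u : U, W (set_val u) <-> A u].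
Proof.
move=> oU; split=> [[B oB BA]|[W [oW _ WA]]].
  exists (U `&` B); split; [exact: openI|by move=> x []|move=> u].
  by rewrite -BA; split=> [[]//|Bu]; split=> //; exact: set_valP.
by exists W => //; apply/seteqP; split=> u /WA.
Qed.

Lemma smooth_open_preimage {d : nat} {U : set 'rV[R]_d} {f : U -> R} {O : set R} :
  open U -> smooth f -> open O -> open (f @^-1` O).
Proof.
move=> oU [g gf /(_ 0%N) [gc _]] oO; apply/(open_subtypeP oU).
exists (U `&` g @^-1` O); split; last 2 first.
- by move=> x [].
- move=> u; rewrite /= gf; split=> [[]//|Ofu]; split=> //; exact: set_valP.
rewrite openE => x [Ux Ogx]; apply: filterI.
  exact: open_nbhs_nbhs.
exact: (gc x Ux) (open_nbhs_nbhs (conj oO Ogx)).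
Qed.

End local_smoothness.

(** * Pulling back the initial topology, and restricting plots *)

Section restriction.
Context {R : realType} {X : Type}.
Implicit Types (D : set (parametrization R X)) (F : set (X -> R)).

Lemma initial_top_coarsest {F} {tau : set (set X)} : is_topology tau ->
  (forall f, F f -> forall O : set R, open O -> tau (f @^-1` O)) ->
  initial_top F `<=` tau.
Proof. by move=> ttau tauF A; apply. Qed.

(** Applying [D_top] to the one-element family [[set p]] gives the topology of
    all sets with open preimage under [p], the finest one for which [p] is
    continuous; it contains the subbasis [f @^-1` O] of the initial topology. *)
Lemma Pi_continuous {F} {p : parametrization R X} : Pi F p ->
  forall A, initial_top F A -> open (p @^-1` A).
Proof.
move=> Pip A FA.
have : D_top [set p] A.
  move: A FA; apply: initial_top_coarsest; first by have [] := D_topP [set p].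
  move=> f Ff O oO; rewrite D_topE => _ ->.
  exact: (smooth_open_preimage (pdom_open p) (Pip f Ff) oO).
by rewrite D_topE; exact.
Qed.

Lemma compatibleP {D F} : compatible D F <-> D `<=` Pi F.
Proof. by split=> [c p Dp f|c p f /c]; [exact: c|exact]. Qed.

Lemma compatible_initial_top {D F} : compatible D F ->
  initial_top F `<=` D_top D.
Proof.
move=> /compatibleP c A FA; rewrite D_topE => p /c Pip.
exact: Pi_continuous Pip A FA.
Qed.

Lemma restrict_plot {D} {p : parametrization R X} {W : set 'rV[R]_(pdim p)}
    (oW : open W) (WU : W `<=` pdom p) : diffeology D -> D p ->
  D (Parametrization oW (p \o subfun WU)).
Proof. by move=> [_ D2 _] Dp; exact/D2/smooth_map_subfun. Qed.

Definition corestrict {T : Type} {V : set X} (phi : T -> X)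
  (phiV : forall t, V (phi t)) (t : T) : V := SigSub (mem_set (phiV t)).

Lemma subspace_sikorski_restrict {F} (V : set X) {f : X -> R} : F f ->
  subspace_sikorski F V (f \o set_val).
Proof.
have [[FT _ _] _] := initial_topP F.
by move=> Ff x; exists setT; [exists setT|exists f].
Qed.

(** A plot has to be cut down to an open set of the cartesian space, whereas
    [p @^-1` V] is a set in the subtype [pdom p]; this translates one into the
    other. *)
Lemma shrink_domain {p : parametrization R X} {V : set X} (u : pdom p) :
  open (p @^-1` V) -> V (p u) ->
  exists (W : set 'rV[R]_(pdim p)) (WU : W `<=` pdom p),
    [/\ open W, W (set_val u) & forall w, V (p (subfun WU w))].
Proof.
move=> /(open_subtypeP (pdom_open p)) [W [oW WU WV]] Vpu.
exists W, WU; split=> // [|w]; first exact/WV.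
exact/(WV (subfun WU w))/(set_valP w).
Qed.

(** * Passing from local to global *)

(** D-openness of [V] means that every plot meeting [V] stays in [V] on an open
    set, where the hypothesis on [V] applies to it. *)
Lemma compatible_local {D F} : diffeology D ->
  (forall x : X, exists V : set X, [/\ D_top D V, V x &
    compatible (subset_diffeology D V) (subspace_sikorski F V)]) ->
  compatible D F.
Proof.
move=> hD loc p f Dp Ff; apply: smooth_local => u.
have [V [DV Vpu cV]] := loc (p u).
have oV : open (p @^-1` V) by move: DV; rewrite D_topE; exact.
have [W [WU [oW Wu pV]]] := shrink_domain u oV Vpu.
exists W, WU; split=> //.
apply: (cV (Parametrization oW (corestrict (p \o subfun WU) pV)) (f \o set_val)).
  exact: (restrict_plot oW WU hD Dp).
exact: subspace_sikorski_restrict.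
Qed.

(** The neighbourhood on which [f] coincides with an element [g] of [F] is
    [V `&` B], which is a neighbourhood for the initial topology, the topology in
    which elements of [F] are glued, because [V] is open for it. *)
Lemma Phi_sub_local {D F} : sikorski_structure F ->
  (forall x : X, exists V : set X, [/\ initial_top F V, V x &
    Phi (subset_diffeology D V) `<=` subspace_sikorski F V]) ->
  Phi D `<=` F.
Proof.
move=> [_ _ S2] loc f Phif; apply: S2 => x.
have [V [FV Vx +]] := loc x.
have PhifV : Phi (subset_diffeology D V) (f \o set_val).
  by move=> p Dp; exact: (Phif (param_comp set_val p)).
move=> /(_ _ PhifV (SigSub (mem_set Vx))) [W [B [FB Bx BW]] [g Fg gf]].
have [[_ FI _] _] := initial_topP F.
exists (V `&` B); first by exists (V `&` B); split=> //; exact: FI.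
exists g => // y /set_mem [Vy /BW Wy].
exact: (gf (SigSub (mem_set Vy)) Wy).
Qed.

(** A function of the subspace structure extends to an element of [F] only near
    each point, so this uses the continuity of [q] for the initial topology
    and the locality of smoothness. *)
Lemma Pi_restrict {F} {V : set X} {q : parametrization R V} :
  Pi F (param_comp set_val q) -> Pi (subspace_sikorski F V) q.
Proof.
move=> Piq f fV; apply: smooth_local => u.
have [W [B [FB Bu BW]] [g Fg gf]] := fV (q u).
have oB := Pi_continuous Piq B FB.
have [W' [W'U [oW' W'u qB]]] :=
  @shrink_domain (param_comp set_val q) B u oB Bu.
exists W', W'U; split=> //.
have -> : f \o q \o subfun W'U = g \o (set_val \o q) \o subfun W'U.
  by apply/funext => w /=; rewrite gf//; exact/BW/qB.
exact: smooth_subfun (pdom_open q) (Piq g Fg).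
Qed.

Lemma Pi_sub_local {D F} : diffeology D ->
  (forall x : X, exists V : set X, [/\ initial_top F V, V x &
    Pi (subspace_sikorski F V) `<=` subset_diffeology D V]) ->
  Pi F `<=` D.
Proof.
move=> [_ _ D3] loc p Pip; apply: D3 => u.
have [V [FV Vpu PiV]] := loc (p u).
have [W [WU [oW Wu pV]]] := shrink_domain u (Pi_continuous Pip V FV) Vpu.
exists W, oW, WU; split=> //.
apply: (PiV (Parametrization oW (corestrict (p \o subfun WU) pV))).
apply: Pi_restrict => f Ff.
exact: (smooth_subfun WU (pdom_open p) (Pip f Ff)).
Qed.

End restriction.

Theorem proposition5p2 (R : realType) (X : Type)
    (D : set (parametrization R X)) (F : set (X -> R))
    (hD : diffeology D) (hF : sikorski_structure F) :
  ((forall x : X, exists V : set X, [/\ D_top D V, V x &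
      compatible (subset_diffeology D V) (subspace_sikorski F V)]) ->
    compatible D F /\ initial_top F `<=` D_top D) /\
  (initial_top F `<=` D_top D ->
    (forall x : X, exists V : set X, [/\ initial_top F V, V x &
      reflexive_triple (subset_diffeology D V) (subspace_sikorski F V)]) ->
    reflexive_triple D F).
Proof.
split=> [loc|FD loc].
  have c := compatible_local hD loc.
  by split=> //; exact: compatible_initial_top.
have c : compatible D F.
  apply: compatible_local => // x; have [V [FV Vx [_ PiV]]] := loc x.
  by exists V; split=> //; [exact: FD|apply/compatibleP; rewrite PiV].
split; apply/seteqP; split.
- apply: Phi_sub_local => // x; have [V [FV Vx [PhiV _]]] := loc x.
  by exists V; split=> //; rewrite PhiV.
- by move=> f Ff p Dp; exact: c.
- apply: Pi_sub_local => // x; have [V [FV Vx [_ PiV]]] := loc x.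
  by exists V; split=> //; rewrite PiV.
- exact/compatibleP.
Qed.
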